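(* Let $W$ be the $n\times n$ random interaction matrix generated either by random mixed interactions or by complex mixed interactions (no self-loops), and let $\tau_d\ge0$ be an integer. Then, for large $n$, the delayed discrete-time system $X(k+1)=W X(k-\tau_d)$ converges to zero; that is, with probability tending to $1$ as $n\to\infty$, for every initial condition $\lim_{k\to\infty}X(k)=0$.
   Context: Fix a real random variable $Z$ with $\mathbb{E}(Z)=0$ and variance $\sigma^2\in(0,\infty)$, and $P\in(0,1]$, not depending on $n$. A random matrix $S=[s_{ij}]\in\mathbb{R}^{n\times n}$ with $s_{ii}=0$ is generated in one of two ways. Random mixed interactions: for each ordered pair $i\ne j$ independently, with probability $P$ the entry $s_{ij}$ is an independent copy of $Z$, and otherwise $s_{ij}=0$. Complex mixed interactions: for each unordered pair $\{i,j\}$, $i\neq j$, independently, with probability $P$ the two individuals interact (otherwise $s_{ij}=s_{ji}=0$). An interacting pair has one of five types, with proportions (probabilities) $P_{+/+},P_{-/-},P_{+/-},P_{+/0},P_{-/0}\ge0$ summing to $1$: $(+/+)$: $s_{ij},s_{ji}$ are independent copies of $|Z|$; $(-/-)$: independent copies of $-|Z|$; $(+/-)$: one of $s_{ij},s_{ji}$ is a copy of $|Z|$ and the other an independent copy of $-|Z|$ (either assignment equally likely); $(+/0)$: one is a copy of $|Z|$, the other is $0$ (equally likely); $(-/0)$: one is a copy of $-|Z|$, the other is $0$ (equally likely). Standing assumption: $P_{+/+}+P_{+/0}<1$ and $P_{-/-}+P_{-/0}<1$. In both cases $w_{ij}=s_{ij}/|S|_i$ for $i\ne j$ and $w_{ii}=0$,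 where $|S|_i=\sum_{j}|s_{ij}|$ (these are all positive with probability tending to $1$ as $n\to\infty$). Initial conditions: $X(0)\in[-1,1]^n$ with $X(0)=X(1)=\dots=X(\tau_d)$, and the recursion is applied for $k\ge\tau_d$. *)

(* Defs.v *)
From HB Require Import structures.
From mathcomp Require Import all_boot all_order all_algebra.
From mathcomp Require Import all_classical all_reals all_analysis.

Set Implicit Arguments.
Unset Strict Implicit.
Unset Printing Implicit Defensive.

Import Order.TTheory GRing.Theory Num.Theory.
Import numFieldNormedType.Exports.

Local Open Scope classical_set_scope.
Local Open Scope ring_scope.

(* Mutual independence of the random elements X i for i in the finite set D:
   the product rule holds for every subfamily J of D. *)
Definition mutually_independent d (T : measurableType d) (R : realType)
    (Pr : probability T R) d' (E : measurableType d') (I : finType)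
    (D : {set I}) (X : I -> T -> E) : Prop :=
  forall J : {set I}, J \subset D ->
  forall A : I -> set E, (forall i, measurable (A i)) ->
    Pr (\bigcap_(i in [set` J]) (X i @^-1` A i)) =
    (\prod_(i in J) Pr (X i @^-1` A i))%E.

Definition random_matrix d (T : measurableType d) (R : realType) (n : nat)
    (S : T -> 'M[R]_n) : Prop :=
  forall i j, measurable_fun setT (fun t => S t i j).

(* Law of an entry which is distributed as Z (of law mu) with probability p and
   is 0 otherwise. *)
Definition mixed_law (R : realType) (mu : probability R R) (p : R)
    (A : set R) : \bar R :=
  (p%:E * mu A + (1 - p)%:E * \d_(0 : R)%R A)%E.

Definition random_mixed d (T : measurableType d) (R : realType)
    (Pr : probability T R) (mu : probability R R) (p : R) (n : nat)
    (S : T -> 'M[R]_n) : Prop :=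
  [/\ random_matrix S,
      forall t i, S t i i = 0,
      forall i j, i != j -> forall A : set R, measurable A ->
        Pr ((fun t => S t i j) @^-1` A) = mixed_law mu p A &
      mutually_independent Pr [set e : 'I_n * 'I_n | e.1 != e.2]%SET
        (fun e t => S t e.1 e.2)].

(* Proportions of the five interaction types +/+, -/-, +/-, +/0, -/0. *)
Record proportions (R : realType) := Proportions {
  ppp : R; pmm : R; ppm : R; pp0 : R; pm0 : R }.

Definition proportions_ok (R : realType) (q : proportions R) : Prop :=
  [/\ [/\ 0 <= ppp q, 0 <= pmm q, 0 <= ppm q, 0 <= pp0 q & 0 <= pm0 q],
      ppp q + pmm q + ppm q + pp0 q + pm0 q = 1,
      ppp q + pp0 q < 1 &
      pmm q + pm0 q < 1].

(* Law of (s_ij, s_ji) for an interacting pair; z.1 and z.2 are two independent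
   copies of Z under mu \x mu. *)
Definition interacting_law (R : realType) (mu : probability R R)
    (q : proportions R) (U : set (R * R)) : \bar R :=
  let law (f : R * R -> R * R) : \bar R := pushforward (mu \x mu)%E f U in
  let coin (f g : R * R -> R * R) : \bar R :=
    (2^-1%:E * law f + 2^-1%:E * law g)%E in
  let pp (z : R * R) : R * R := (`|z.1|, `|z.2|) in
  let mm (z : R * R) : R * R := (- `|z.1|, - `|z.2|) in
  let pm (z : R * R) : R * R := (`|z.1|, - `|z.2|) in
  let mp (z : R * R) : R * R := (- `|z.1|, `|z.2|) in
  let p0 (z : R * R) : R * R := (`|z.1|, 0) in
  let zp (z : R * R) : R * R := (0, `|z.2|) in
  let m0 (z : R * R) : R * R := (- `|z.1|, 0) in
  let zm (z : R * R) : R * R := (0, - `|z.2|) in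
  ((ppp q)%:E * law pp + (pmm q)%:E * law mm + (ppm q)%:E * coin pm mp
   + (pp0 q)%:E * coin p0 zp + (pm0 q)%:E * coin m0 zm)%E.

Definition complex_law (R : realType) (mu : probability R R) (p : R)
    (q : proportions R) (U : set (R * R)) : \bar R :=
  (p%:E * interacting_law mu q U + (1 - p)%:E * \d_((0, 0) : R * R)%R U)%E.

(* The unordered pair {i, j} is represented by (i, j) with i < j. *)
Definition complex_mixed d (T : measurableType d) (R : realType)
    (Pr : probability T R) (mu : probability R R) (p : R) (q : proportions R)
    (n : nat) (S : T -> 'M[R]_n) : Prop :=
  [/\ random_matrix S,
      forall t i, S t i i = 0,
      forall i j : 'I_n, (i < j)%N ->
        forall U : set (R * R), measurable U ->
        Pr ((fun t => (S t i j, S t j i)) @^-1` U) = complex_law mu p q U &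
      mutually_independent Pr [set e : 'I_n * 'I_n | (e.1 < e.2)%N]%SET
        (fun e t => (S t e.1 e.2, S t e.2 e.1))].

(* w_ij = s_ij / |S|_i off the diagonal.  A row with |S|_i = 0 is zero, so the
   totalized division gives a zero row of W there. *)
Definition interaction_matrix (R : realType) (n : nat) (S : 'M[R]_n) : 'M[R]_n :=
  \matrix_(i, j) if i == j then 0 else S i j / \sum_k `|S i k|.

Definition delayed_trajectory (R : realType) (n : nat) (W : 'M[R]_n)
    (tau : nat) (X : nat -> 'cV[R]_n) : Prop :=
  [/\ forall i, -1 <= X 0 i 0 <= 1,
      forall k, (k <= tau)%N -> X k = X 0 &
      forall k, (tau <= k)%N -> X k.+1 = W *m X (k - tau)%N].

Definition converges_to_zero (R : realType) (n : nat) (W : 'M[R]_n)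
    (tau : nat) : Prop :=
  forall X : nat -> 'cV[R]_n, delayed_trajectory W tau X ->
    X k @[k --> \oo] --> (0 : 'cV[R]_n).

(* Main.v *)
Require Import Defs.
From HB Require Import structures.
From mathcomp Require Import all_boot all_order all_algebra.
From mathcomp Require Import all_classical all_reals all_analysis.
From mathcomp Require Import measurable_realfun.
From mathcomp Require Import ring lra.
Import Order.TTheory GRing.Theory Num.Theory.
Import numFieldNormedType.Exports.
Local Open Scope classical_set_scope.
Local Open Scope ring_scope.

(** Along a trajectory X(k) = W^q X(0) with q = floor (k / (tau + 1)), and every
    row of W has l1-norm at most 1; hence the system converges to zero iff some
    positive power of W has all its row norms below 1 (which also makes the event
    measurable).  The square of W does: its i-th row norm is below 1 as soon as,
    for some l, there are two paths i -> j -> l whose weights have opposite signs,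
    since these cancel in the entry (i, l).  As Z is centered and nondegenerate,
    both signs occur at each position with probability at least some c > 0.  For
    fixed i != l the n - 2 paths i -> j -> l use pairwise distinct unordered pairs,
    so they are independent, and all of them miss a given sign pattern with
    probability at most (1 - c^2)^(n - 2).  A union bound over i leaves
    2 n (1 - c^2)^(n - 2), which tends to 0. *)

Set Implicit Arguments.
Unset Strict Implicit.
Unset Printing Implicit Defensive.

(** * Entrywise limits, row norms and the convergence criterion *)

Lemma cvg_mxP (R : realType) (m n : nat) (X : nat -> 'M[R]_(m, n)) (M : 'M[R]_(m, n)) :
  X k @[k --> \oo] --> M <-> forall i j, X k i j @[k --> \oo] --> M i j.
Proof.
split=> [XM i j A MA|XM A [P MP PA]].
  apply: (XM [set N : 'M[R]_(m, n) | A (N i j)]).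
  exists (fun i' j' => if (i' == i) && (j' == j) then A else setT).
    move=> i' j'; case: ifP => [/andP[/eqP-> /eqP->] //|_]; exact: filterT.
  by move=> N /= /(_ i j); rewrite !eqxx.
have : \forall k \near \oo, forall i j, P i j (X k i j).
  by apply: filter_forall => i; apply: filter_forall => j; exact: XM (MP i j).
by apply: filterS => k; exact: PA.
Qed.

Definition row_norm (R : realType) (n : nat) (A : 'M[R]_n) (i : 'I_n) : R :=
  \sum_j `|A i j|.

Section row_norm.
Context {R : realType} {n : nat}.
Implicit Types A B : 'M[R]_n.

Lemma row_norm_ge0 A i : 0 <= row_norm A i.
Proof. by apply: sumr_ge0. Qed.

Lemma norm_mulmx_le A B i j : `|(A *m B) i j| <= \sum_k `|A i k| * `|B k j|.
Proof.
by rewrite mxE (le_trans (ler_norm_sum _ _ _))// ler_sum// => k _; rewrite normrM.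
Qed.

Lemma row_norm_mul A B (b : R) i : (forall k, row_norm B k <= b) ->
  row_norm (A *m B) i <= row_norm A i * b.
Proof.
move=> Bb; rewrite /row_norm mulr_suml.
rewrite (le_trans (ler_sum _ (fun j _ => norm_mulmx_le A B i j)))//.
rewrite exchange_big/= ler_sum// => k _.
by rewrite -mulr_sumr ler_wpM2l//; exact: Bb.
Qed.

Lemma row_norm1 i : row_norm (1 : 'M[R]_n) i = 1.
Proof.
rewrite /row_norm (bigD1 i)//= mxE eqxx normr1 big1 ?addr0// => j ji.
by rewrite mxE eq_sym (negbTE ji) normr0.
Qed.

Lemma row_norm_exp A (a : R) k i : 0 <= a -> (forall k, row_norm A k <= a) ->
  row_norm (A ^+ k) i <= a ^+ k.
Proof.
move=> a0 Aa; elim: k i => [|k IH] i; first by rewrite !expr0 row_norm1.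
rewrite exprS (le_trans (row_norm_mul _ _ IH))//.
by rewrite exprS ler_wpM2r// exprn_ge0.
Qed.

Lemma mulmx_row_norm_le A (x : 'cV[R]_n) i : (forall j, `|x j 0| <= 1) ->
  `|(A *m x) i 0| <= row_norm A i.
Proof.
move=> x1; rewrite mxE (le_trans (ler_norm_sum _ _ _))// ler_sum// => j _.
by rewrite normrM ler_piMr.
Qed.

(** The trajectory is constant on blocks of [tau.+1] consecutive times, and passing to the next
    block applies [A] once. *)
Lemma trajectoryE A tau X : delayed_trajectory A tau X ->
  forall k, X k = A ^+ (k %/ tau.+1) *m X 0%N.
Proof.
move=> [_ X0 XS]; elim/ltn_ind => k IH.
have [ktau|tauk] := leqP k tau.
  by rewrite X0// divn_small// expr0 mul1mx.
case: k tauk IH => // k; rewrite ltnS => tauk IH.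
rewrite XS// IH ?ltnS ?leq_subr// mulmxA -[A *m _]/(A * _) -exprS.
(* [k.+1] is [(k - tau) + tau.+1], so its quotient by [tau.+1] is exactly one larger. *)
by rewrite -{2}(subnK tauk) -addnS divnDr// divnn/= addn1.
Qed.

(** Supplies trajectories to test convergence on: every vector of the cube is an admissible
    start. *)
Lemma power_trajectory A tau (x : 'cV[R]_n) : (forall i, -1 <= x i 0 <= 1) ->
  delayed_trajectory A tau (fun k => A ^+ (k %/ tau.+1) *m x).
Proof.
move=> x1; split=> [i|k ktau|k tauk].
- by rewrite div0n expr0 mul1mx.
- by rewrite div0n divn_small.
- rewrite mulmxA -[A *m _]/(A * _) -exprS.
  by rewrite -{1}(subnK tauk) -addnS divnDr// divnn/= addn1.
Qed.

Lemma cvg_expr_divn (r : R) (m : nat) : 0 <= r < 1 ->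
  r ^+ (k %/ m.+1) @[k --> \oo] --> (0 : R).
Proof.
move=> /andP[r0 r1].
apply: (@cvg_comp _ _ _ (fun k => k %/ m.+1)%N (fun k => r ^+ k) _ \oo).
  move=> P [N _ NP]; exists (N * m.+1)%N => // k /= Nk.
  by apply: NP => /=; rewrite leq_divRL.
by apply: cvg_expr; rewrite ger0_norm.
Qed.

(** Forward: starting at the basis vectors shows that every entry of the powers tends to [0].
    Backward: if all row norms of [A ^+ k.+1] are at most some [r < 1], each block of [k.+1] factors
    gains a factor [r]. *)
Lemma converges_to_zeroP A tau : (forall i, row_norm A i <= 1) ->
  converges_to_zero A tau <-> exists k, forall i, row_norm (A ^+ k.+1) i < 1.
Proof.
move=> A1; split=> [Acvg|[k Ak] X AX].
  have cvgA i j : (A ^+ (k %/ tau.+1)) i j @[k --> \oo] --> (0 : R).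
    have /Acvg /cvg_mxP /(_ i 0) :
        delayed_trajectory A tau (fun k => A ^+ (k %/ tau.+1) *m delta_mx j 0).
      apply: power_trajectory => k; rewrite mxE eqxx andbT.
      by case: (k == j) => /=; rewrite ?lexx ?ler01 ?lerN10 ?andbT ?(le_trans (lerN10 _) ler01).
    rewrite mxE; under eq_fun do rewrite -colE mxE.
    exact.
  have : \forall k \near \oo, forall i, row_norm (A ^+ (k %/ tau.+1)) i < 1.
    (* With entries below [1 / (n + 1)], a row of [n] entries sums to at most [n / (n + 1) < 1]. *)
    have : \forall k \near \oo, forall i j,
        `|(A ^+ (k %/ tau.+1)) i j| < n.+1%:R^-1.
      apply: filter_forall => i; apply: filter_forall => j.
      by have /cvgr0Pnorm_lt := cvgA i j; apply; rewrite invr_gt0.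
    apply: filterS => k Ak i.
    apply: (@le_lt_trans _ _ (\sum_(j < n) n.+1%:R^-1)).
      by apply: ler_sum => j _; exact/ltW.
    by rewrite sumr_const card_ord -[_ *+ _]mulr_natl ltr_pdivrMr// mul1r ltr_nat.
  (* The time [N.+1 * tau.+1] is past the threshold [N], and the power reached there is exactly
     [N.+1], hence positive. *)
  case=> N _ NA; exists N => i; have := NA (N.+1 * tau.+1)%N _ i.
  by rewrite mulnK//; apply => /=; rewrite (leq_trans (leqnSn N))// leq_pmulr.
pose r := \big[Num.max/0]_i row_norm (A ^+ k.+1) i.
have r0 : 0 <= r by apply: bigmax_ge_id.
have r1 : r < 1 by apply: bigmax_lt.
have Xr q i : `|X q i 0| <= r ^+ (q %/ (tau.+1 * k.+1)).
  have X01 j : `|X 0%N j 0| <= 1 by rewrite ler_norml; case: AX.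
  rewrite (trajectoryE AX) (le_trans (mulmx_row_norm_le _ _ X01))//.
  (* Euclidean division of the exponent by [k.+1]: the full blocks give the power of [r], and the
     remaining power of [A] has row norms at most [1]. *)
  rewrite divnMA [in leLHS](divn_eq (q %/ tau.+1) k.+1) exprD mulnC exprM.
  rewrite (le_trans (row_norm_mul (b := 1) _ _ _))//.
    by move=> j; rewrite (le_trans (row_norm_exp _ _ ler01 A1))// expr1n.
  rewrite mulr1 row_norm_exp// => j; exact: le_bigmax.
apply/cvg_mxP => i j; rewrite ord1 mxE.
apply: norm_cvg0.
have := @cvg_expr_divn r (tau * k.+1 + k); rewrite r0 r1 => /(_ isT).
rewrite (_ : (tau * k.+1 + k).+1 = tau.+1 * k.+1)%N; last by rewrite mulSn addnC.
apply: (@squeeze_cvgr _ _ _ _ (cst 0)); last exact: cvg_cst.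
by apply: nearW => q; rewrite normr_ge0 Xr.
Qed.

End row_norm.

(** * Signs and row norms of the interaction matrix, and cancellation in its square *)

Section interaction_matrix.
Context {R : realType} {n : nat}.
Implicit Type S : 'M[R]_n.

(** A nonzero [S i j] contributes to its own row sum, so the divisor is positive; a zero entry stays
    zero whatever the divisor. *)
Lemma interaction_matrix_sgr S i j : i != j ->
  Num.sg (interaction_matrix S i j) = Num.sg (S i j).
Proof.
move=> ij; rewrite mxE (negbTE ij) sgrM sgrV.
have [->|Sij] := eqVneq (S i j) 0; first by rewrite sgr0 mul0r.
rewrite [X in _ * X]gtr0_sg ?mulr1// (lt_le_trans (_ : 0 < `|S i j|)) ?normr_gt0//.
by rewrite (bigD1 j)//= lerDl sumr_ge0.
Qed.

Lemma row_norm_interaction_matrix S i : row_norm (interaction_matrix S) i <= 1.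
Proof.
set s := \sum_k `|S i k|; have s0 : 0 <= s by apply: sumr_ge0.
apply: (@le_trans _ _ (\sum_j `|S i j| / s)).
  apply: ler_sum => j _; rewrite mxE; case: ifP => _.
    by rewrite normr0 divr_ge0.
  by rewrite normrM normfV (ger0_norm s0).
rewrite -mulr_suml -/s; have [->|s_neq0] := eqVneq s 0; first by rewrite mul0r.
by rewrite divff.
Qed.

(* Two paths of length two from [i] to [l] with weights of opposite signs
   partially cancel in the [(i, l)] entry of the square. *)
Lemma row_norm_sqr_lt1 (A : 'M[R]_n) i l j1 j2 : (forall k, row_norm A k <= 1) ->
  0 < A i j1 * A j1 l -> A i j2 * A j2 l < 0 -> row_norm (A ^+ 2) i < 1.
Proof.
move=> A1 pos neg.
apply: (@lt_le_trans _ _ (\sum_j \sum_k `|A i k| * `|A k j|)); last first.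
  rewrite exchange_big/=; apply: le_trans (A1 i); apply: ler_sum => k _.
  by rewrite -mulr_sumr ler_piMr//; exact: A1.
have ltN (f : 'I_n -> R) k : f k < 0 -> \sum_k f k < \sum_k `|f k|.
  move=> fk; rewrite (bigD1 k)//= [ltRHS](bigD1 k)//= ltr_leD ?ler_sum// => [|i0 _].
    by rewrite (lt_le_trans fk).
  exact: ler_norm.
(* Only column [l] has to be strict; the other columns use the triangle inequality. *)
rewrite /row_norm expr2 -[A * A]/(A *m A) (bigD1 l)//= [ltRHS](bigD1 l)//=.
apply: ltr_leD; last by apply: ler_sum => j _; exact: norm_mulmx_le.
rewrite [(_ *m _) i l]mxE lter_norml/=.
under eq_bigr do rewrite -normrM.
(* Of the two one-sided bounds, the upper one is strict because the path through [j2] has negative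
   weight, the lower one because the path through [j1] has positive weight. *)
rewrite ltrNl -sumrN (ltN _ j2)// andbT.
under [ltRHS]eq_bigr do rewrite -normrN.
by rewrite (ltN _ j1)// oppr_lt0.
Qed.

End interaction_matrix.

(** * Measurability of the convergence event *)

Lemma measurable_set_gt0 (R : realType) : measurable [set x : R | 0 < x].
Proof. by rewrite -set_itvoy; exact: measurable_itv. Qed.

Lemma measurable_set_lt0 (R : realType) : measurable [set x : R | x < 0].
Proof. by rewrite -set_itvNyo; exact: measurable_itv. Qed.

Section measurability.
Context {R : realType} d (T : measurableType d) (n : nat).
Implicit Type S : T -> 'M[R]_n.

Lemma random_matrix_mul S1 S2 : random_matrix S1 -> random_matrix S2 ->
  random_matrix (fun t => S1 t *m S2 t).
Proof.
move=> mS1 mS2 i j; under eq_fun do rewrite mxE.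
by apply: measurable_sum => k; exact: measurable_funM.
Qed.

Lemma random_matrix_exp S k : random_matrix S ->
  random_matrix (fun t => S t ^+ k).
Proof.
move=> mS; elim: k => [i j|k IH].
  by under eq_fun do rewrite expr0; exact: measurable_cst.
move=> i j; under eq_fun do rewrite exprS.
exact: random_matrix_mul.
Qed.

Lemma measurable_row_norm S i : random_matrix S ->
  measurable_fun setT (fun t => row_norm (S t) i).
Proof.
by move=> mS; apply: measurable_sum => j; exact: measurableT_comp (mS i j).
Qed.

(** Inversion is continuous on the open complement of [0], and the point [0] is treated
    separately. *)
Lemma measurable_invr : measurable_fun setT (@GRing.inv R).
Proof.
rewrite -(setUv [set (0 : R)]); apply/measurable_funU => //.
  exact: measurableC.
split; first exact: measurable_fun_set1.
apply: open_continuous_measurable_fun.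
  by rewrite openC; exact: closed_eq.
by move=> x; rewrite inE/= => /eqP x0; exact: inv_continuous.
Qed.

Lemma random_interaction_matrix S : random_matrix S ->
  random_matrix (fun t => interaction_matrix (S t)).
Proof.
move=> mS i j; under eq_fun do rewrite mxE.
case: (i == j); first exact: measurable_cst.
apply: measurable_funM; first exact: mS.
apply: measurableT_comp measurable_invr _.
exact: (measurable_row_norm i mS).
Qed.

(** The definition quantifies over uncountably many trajectories; the row norm criterion turns it
    into a countable union of finite intersections. *)
Lemma measurable_converges_to_zero S tau : random_matrix S ->
  measurable [set t | converges_to_zero (interaction_matrix (S t)) tau].
Proof.
move=> mS.
rewrite (_ : [set t | _] = \bigcup_k \bigcap_i
    ((fun t => row_norm (interaction_matrix (S t) ^+ k.+1) i) @^-1` [set x | x < 1])).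
  apply: bigcup_measurable => k _; apply: fin_bigcap_measurable => // i _.
  have mW := measurable_row_norm i
    (random_matrix_exp k.+1 (random_interaction_matrix mS)).
  have := mW measurableT _ (measurable_itv `]-oo, 1[).
  by rewrite setTI set_itvNyo.
apply/seteqP; split=> t /=.
  by move/(converges_to_zeroP _ (row_norm_interaction_matrix _)) => [k Wk]; exists k => // i _; exact: Wk.
move=> [k _ Wk]; apply/(converges_to_zeroP _ (row_norm_interaction_matrix _)).
by exists k => i; exact: Wk.
Qed.

End measurability.

(** * Independence of the two-step paths between two vertices *)

Section independence.
Context d (T : measurableType d) (R : realType) (Pr : probability T R).

(* Proved together with the intersections of the events themselves, which is
   what makes the induction on [s] go through. *)
Lemma probability_bigsetI_setC (I : eqType) (F : I -> set T) (x : I -> R)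
    (D : pred I) :
  (forall i, measurable (F i)) ->
  (forall r, uniq r -> all D r ->
    Pr (\big[setI/setT]_(i <- r) F i) = (\prod_(i <- r) x i)%:E) ->
  forall s r, uniq (s ++ r) -> all D (s ++ r) ->
    Pr (\big[setI/setT]_(i <- s) ~` F i `&` \big[setI/setT]_(i <- r) F i) =
    (\prod_(i <- s) (1 - x i) * \prod_(i <- r) x i)%:E.
Proof.
move=> mF PF; elim=> [|a s IH] r usr Dsr.
  by rewrite !big_nil setTI mul1r PF.
(* Intersecting with the complement of [F a] is a set difference: the subtracted term has [F a]
   moved to the second list, and the induction hypothesis covers both terms. *)
rewrite !big_cons -setIA setIC -setDE.
have mI q : measurable (\big[setI/setT]_(i <- q) F i).
  by apply: bigsetI_measurable.
have mC q : measurable (\big[setI/setT]_(i <- q) ~` F i).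
  by apply: bigsetI_measurable => i _; exact: measurableC.
rewrite measureD//; [|exact: measurableI|by rewrite ltey_eq fin_num_measure//; exact: measurableI].
rewrite -setIA (setIC _ (F a)).
move: usr Dsr => /=/andP[asr usr]/andP[Da Dsr].
have := IH (a :: r); rewrite !big_cons => ->; last 2 first.
  by rewrite uniq_catC/= mem_cat orbC -mem_cat asr uniq_catC.
  by move: Dsr; rewrite !all_cat/= Da.
by rewrite IH// -EFinB; congr EFin; ring.
Qed.

End independence.

(* Up to a common lower bound on the probabilities of the two signs, this is all
   that the two models have in common: independence is only required of sets of
   ordered pairs in which no unordered pair appears twice. *)
Definition mixed_signs d (T : measurableType d) (R : realType)
    (Pr : probability T R) (c : R) (n : nat) (S : T -> 'M[R]_n) : Prop :=
  [/\ random_matrix S,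
      forall i j, i != j -> (c%:E <= Pr [set t | 0 < S t i j]%R)%E,
      forall i j, i != j -> (c%:E <= Pr [set t | S t i j < 0]%R)%E &
      forall E : {set 'I_n * 'I_n},
        (forall e, e \in E -> (e.1 != e.2) && ((e.2, e.1) \notin E)) ->
        mutually_independent Pr E (fun e t => S t e.1 e.2)].

Section two_step.
Context d (T : measurableType d) (R : realType) (Pr : probability T R) (n : nat).
Variables (S : T -> 'M[R]_n) (c : R).
Hypotheses (c0 : 0 <= c) (Smix : mixed_signs Pr c S).

Let mS : random_matrix S. Proof. by case: Smix. Qed.

Let mSB i j (B : set R) : measurable B -> measurable [set t | B (S t i j)].
Proof.
by move=> mB; rewrite -[X in measurable X]setTI; exact: (mS i j).
Qed.

Lemma probability_no_two_step (i l : 'I_n) (B1 B2 : set R) : i != l ->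
  measurable B1 -> measurable B2 ->
  (forall j, j != i -> j != l -> (c%:E <= Pr [set t | B1 (S t i j)])%E) ->
  (forall j, j != i -> j != l -> (c%:E <= Pr [set t | B2 (S t j l)])%E) ->
  (Pr [set t | forall j, j != i -> j != l -> ~ (B1 (S t i j) /\ B2 (S t j l))]
    <= ((1 - c ^+ 2) ^+ n.-2)%:E)%E.
Proof.
move=> il mB1 mB2 cB1 cB2.
pose F j := [set t | B1 (S t i j) /\ B2 (S t j l)].
have mF j : measurable (F j) by apply: measurableI; exact: mSB.
pose D := [pred j | (j != i) && (j != l)].
pose x1 j := fine (Pr [set t | B1 (S t i j)]).
pose x2 j := fine (Pr [set t | B2 (S t j l)]).
have finPr A : measurable A -> Pr A = (fine (Pr A))%:E.
  by move=> mA; rewrite fineK// fin_num_measure.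
have PF r : uniq r -> all D r ->
    Pr (\big[setI/setT]_(j <- r) F j) = (\prod_(j <- r) (x1 j * x2 j))%:E.
  move=> ur /allP Dr.
  pose J := [set j in r]%SET.
  have JD j : j \in J -> (j != i) && (j != l) by rewrite inE => /Dr.
  (* The edges of all paths through [J]. None is the reverse of another, since [i != l] and [J]
     avoids both endpoints. *)
  pose E := (pair i @: J :|: (fun j => (j, l)) @: J)%SET.
  have EP e : reflect ((e.1 = i /\ e.2 \in J) \/ (e.2 = l /\ e.1 \in J)) (e \in E).
    apply: (iffP setUP) => [[/imsetP[j jJ ->]|/imsetP[j jJ ->]]|]; [by left|by right|].
    case: e => e1 e2 /= [[-> eJ]|[-> eJ]]; [left|right]; exact: imset_f.
  have Eok e : e \in E -> (e.1 != e.2) && ((e.2, e.1) \notin E).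
    case: e => e1 e2 /EP /= [[-> /JD/andP[e2i e2l]]|[-> /JD/andP[e1i e1l]]].
      rewrite eq_sym e2i; apply/EP => /= -[[/eqP]|[/eqP]]; rewrite ?(negbTE e2i)// (negbTE il)//.
    rewrite e1l; apply/EP => /= -[[/eqP]|[/eqP]]; rewrite ?(negbTE e1l)// eq_sym (negbTE il)//.
  (* First steps are exactly the edges of [E] leaving [i], because no second step starts at [i]. *)
  pose A (e : 'I_n * 'I_n) := if e.1 == i then B1 else B2.
  have mA e : measurable (A e) by rewrite /A; case: ifP.
  case: Smix => _ _ _ /(_ E Eok E (subxx _) A mA).
  rewrite (_ : \bigcap_(e in _) _ = \big[setI/setT]_(j <- r) F j); last first.
    rewrite -bigcap_seq; apply/seteqP; split=> t /= H.
      move=> j /= jr; have jJ : j \in J by rewrite inE.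
      split; first by have := H (i, j); rewrite /A/= eqxx; apply; apply/EP; left.
      have /andP[ji _] := JD _ jJ.
      by have := H (j, l); rewrite /A/= (negbTE ji); apply; apply/EP; right.
    case=> e1 e2 /= /EP /= [[-> eJ]|[-> eJ]]; rewrite /A/=.
      by rewrite eqxx; apply: (H e2 _).1; move: eJ; rewrite inE.
    have /andP[/negbTE -> _] := JD _ eJ.
    by apply: (H e1 _).2; move: eJ; rewrite inE.
  move=> ->.
  rewrite (eq_bigl (fun e => e \in [predU pair i @: J & (fun j => (j, l)) @: J]%SET)); last first.
    by move=> e; rewrite finset.in_setU [RHS]inE.
  rewrite bigU/=; last first.
    apply/pred0P => e /=; apply/negP => /andP[/imsetP[j jJ ->] /imsetP[k kJ [ik _]]].
    by have := JD _ kJ; rewrite -ik eqxx.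
  rewrite !big_imset/=; [|by move=> ? ? ? ? []|by move=> ? ? ? ? []].
  rewrite -big_split/= -prodEFin (eq_bigl (fun j => j \in r)); last by move=> j; rewrite inE.
  rewrite -big_uniq//=; apply: eq_big_seq => j /Dr /andP[/negbTE ji _].
  by rewrite /A/= eqxx ji EFinM -!finPr//; exact: mSB.
(* All intermediate vertices go to the complemented list, none to the other. *)
have := probability_bigsetI_setC mF PF (s := seq.filter D (index_enum 'I_n)) (r := [::]).
rewrite big_nil setIT cats0 filter_uniq ?index_enum_uniq// filter_all big_nil mulr1 => /(_ isT isT).
rewrite -bigcap_seq [X in Pr X](_ : _ =
  [set t | forall j, j != i -> j != l -> ~ (B1 (S t i j) /\ B2 (S t j l))]); last first.
  apply/seteqP; split=> t /= H.
    by move=> j ji jl; apply: H; rewrite /= mem_filter /= ji jl mem_index_enum.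
  by move=> j /=; rewrite mem_filter => /andP[/andP[ji jl] _]; exact: H.
move=> ->; rewrite lee_fin big_filter.
have card_D : #|D| = n.-2.
  rewrite -subn2 -[in RHS](card_ord n) -(cardC (mem [set i; l]%SET)) cards2 il addnC addnK.
  by apply: eq_card => j; rewrite !inE negb_or.
rewrite -card_D -prodr_const; apply: ler_prod => j /andP[ji jl].
have le1 A : measurable A -> fine (Pr A) <= 1.
  by move=> mA; rewrite -lee_fin -finPr// probability_le1.
have x1c : c <= x1 j by rewrite -lee_fin -finPr; [exact: cB1|exact: mSB].
have x2c : c <= x2 j by rewrite -lee_fin -finPr; [exact: cB2|exact: mSB].
have x11 : x1 j <= 1 by apply: le1; exact: mSB.
have x21 : x2 j <= 1 by apply: le1; exact: mSB.
by apply/andP; split; [rewrite subr_ge0 mulr_ile1 ?(le_trans c0)|rewrite lerB// expr2 ler_pM].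
Qed.

End two_step.

(** * The union bound over rows and its limit *)

(** With [q] the square root of [r], one factor [q ^+ n] absorbs [n] by a Bernoulli-type bound, and
    the other still tends to [0]. *)
Lemma cvg_natr_mul_expr (R : realType) (r : R) : 0 <= r < 1 ->
  n%:R * r ^+ n @[n --> \oo] --> (0 : R).
Proof.
move=> /andP[r0 r1]; pose q := Num.sqrt r.
have q0 : 0 <= q by exact: sqrtr_ge0.
have q1 : q < 1 by rewrite -sqrtr1 ltr_sqrt.
have bernoulli n : n%:R * (1 - q) * q ^+ n <= 1 - q ^+ n.
  elim: n => [|n IH]; first by rewrite !mul0r expr0 subrr.
  have := exprn_ile1 n.+1 q0 (ltW q1); have := exprn_ge0 n q0.
  by rewrite exprS -natr1 => ? ?; nra.
apply: (@squeeze_cvgr _ _ _ _ (cst 0) (fun n => (1 - q)^-1 * q ^+ n)).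
- apply: nearW => n; rewrite mulr_ge0 ?exprn_ge0//=.
  have -> : r ^+ n = q ^+ n * q ^+ n by rewrite -exprMn -expr2 sqr_sqrtr.
  rewrite ler_pdivlMl ?subr_gt0// mulrCA !mulrA ler_piMl ?exprn_ge0//.
  by rewrite (le_trans (bernoulli n))// lerBlDr lerDl exprn_ge0.
- exact: cvg_cst.
- by have := @cvg_geometric R (1 - q)^-1 q; rewrite ger0_norm//; apply.
Qed.

Lemma content_bigsetU_le d (T : measurableType d) (R : realType)
    (mu : {measure set T -> \bar R}) (I : Type) (s : seq I) (A : I -> set T) :
  (forall i, measurable (A i)) ->
  (mu (\big[setU/set0]_(i <- s) A i) <= \sum_(i <- s) mu (A i))%E.
Proof.
move=> mA; elim: s => [|i s IH]; first by rewrite !big_nil measure0.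
rewrite !big_cons; apply: le_trans (measureU2 _ (mA i) _) _.
  by apply: bigsetU_measurable.
by rewrite leeD2l.
Qed.

Section stability.
Context d (T : measurableType d) (R : realType) (Pr : probability T R) (n : nat).
Variables (S : T -> 'M[R]_n.+2) (c : R) (tau : nat).
Hypotheses (c0 : 0 <= c) (Smix : mixed_signs Pr c S).

Lemma probability_converges_to_zero_ge :
  ((1 - (n.+2%:R * ((1 - c ^+ 2) ^+ n *+ 2)))%:E <=
    Pr [set t | converges_to_zero (interaction_matrix (S t)) tau])%E.
Proof.
have [mS cpos cneg _] := Smix.
pose stable := [set t | converges_to_zero (interaction_matrix (S t)) tau].
have mstable : measurable stable by exact: measurable_converges_to_zero.
(* Any endpoint other than [i] would do; one exists because there are at least two vertices. *)
pose l (i : 'I_n.+2) : 'I_n.+2 := if i == ord0 then ord_max else ord0.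
have il i : i != l i by rewrite /l; case: ifPn => // /eqP ->.
(* The first step is always taken positive, so the sign of the second step is the sign of the
   path. *)
pose no_path (B : set R) i := [set t | forall j, j != i -> j != l i ->
  ~ (0 < S t i j /\ B (S t j (l i)))].
pose Pos : set R := [set x | 0 < x]; pose Neg : set R := [set x | x < 0].
have mPos : measurable Pos by exact: measurable_set_gt0.
have mNeg : measurable Neg by exact: measurable_set_lt0.
have no_path_le B i : measurable B ->
    (forall j, j != l i -> (c%:E <= Pr [set t | B (S t j (l i))])%E) ->
    (Pr (no_path B i) <= ((1 - c ^+ 2) ^+ n)%:E)%E.
  move=> mB cB; apply: (probability_no_two_step c0 Smix (il i) mPos mB) => j ji jl.
    by apply: cpos; rewrite eq_sym.
  exact: cB.
have mno_path B i : measurable B -> measurable (no_path B i).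
  move=> mB; rewrite (_ : no_path B i = \bigcap_(j in [set j | j != i /\ j != l i])
      ~` ([set t | Pos (S t i j)] `&` [set t | B (S t j (l i))])).
    apply: fin_bigcap_measurable => [|j _]; [exact: finite_finset|apply: measurableC].
    by apply: measurableI; rewrite -[X in measurable X]setTI; exact: mS.
  apply/seteqP; split=> t /= H j; first by move=> [ji jl]; exact: H.
  by move=> ji jl; apply: H.
have stable_sup : ~` stable `<=`
    \big[setU/set0]_i (no_path Pos i `|` no_path Neg i).
  move=> t; apply: contra_notP => Hn.
  apply/(converges_to_zeroP _ (row_norm_interaction_matrix _)); exists 1%N => i.
  have path B : measurable B -> ~ no_path B i t ->
      exists j, [/\ j != i, j != l i, 0 < S t i j & B (S t j (l i))].
    move=> mB; rewrite /no_path/= => /existsNP[j].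
    by move=> /not_implyP[ji] /not_implyP[jl] /contrapT[? ?]; exists j.
  have notin : ~ (no_path Pos i `|` no_path Neg i) t.
    by move=> H; apply: Hn; rewrite -bigcup_seq; exists i => //=; exact: mem_index_enum.
  have [|j1 [j1i j1l pos1 pos2]] := path Pos mPos _; first by move=> H; apply: notin; left.
  have [|j2 [j2i j2l pos3 neg]] := path Neg mNeg _; first by move=> H; apply: notin; right.
  apply: (@row_norm_sqr_lt1 _ _ _ i (l i) j1 j2).
  - exact: row_norm_interaction_matrix.
  - by rewrite -sgr_gt0 sgrM !interaction_matrix_sgr// 1?eq_sym// -sgrM sgr_gt0 mulr_gt0.
  - by rewrite -sgr_lt0 sgrM !interaction_matrix_sgr// 1?eq_sym// -sgrM sgr_lt0 pmulr_rlt0.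
have : (Pr (~` stable) <= (n.+2%:R * ((1 - c ^+ 2) ^+ n *+ 2))%:E)%E.
  apply: le_trans (le_measure _ _ _ stable_sup) _.
  - by rewrite inE; exact: measurableC.
  - by rewrite inE; apply: bigsetU_measurable => i _; apply: measurableU; exact: mno_path.
  apply: le_trans (content_bigsetU_le _ _ _) _.
    by move=> i; apply: measurableU; exact: mno_path.
  apply: (@le_trans _ _ (\sum_(i < n.+2) ((1 - c ^+ 2) ^+ n *+ 2)%:E)%E).
    apply: lee_sum => i _; apply: le_trans (measureU2 _ _ _) _; [exact: mno_path|exact: mno_path|].
    rewrite mulr2n EFinD leeD//; apply: no_path_le => // j jl; [exact: cpos|exact: cneg].
  by rewrite sumEFin sumr_const card_ord mulr_natl.
rewrite probability_setC// EFinB => le1.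
by rewrite leeBlDr// addeC -leeBlDr// ?fin_num_measure.
Qed.

End stability.

Lemma cvg_probability_converges_to_zero (R : realType) (c : R) (tau : nat)
    (d : nat -> measure_display) (T : forall n : nat, measurableType (d n))
    (Pr : forall n : nat, probability (T n) R)
    (S : forall n : nat, T n -> 'M[R]_n) :
  0 < c <= 1 -> (forall n, mixed_signs (Pr n) c (@S n)) ->
  Pr n [set t | converges_to_zero (interaction_matrix (S n t)) tau] @[n --> \oo]
    --> 1%E.
Proof.
move=> /andP[c0 c1] Smix.
pose r := 1 - c ^+ 2.
(* The lower bound is stated for size [n.+2], so the sequence is shifted by two. *)
have : (fun n => Pr (n + 2)%N
    [set t | converges_to_zero (interaction_matrix (S (n + 2)%N t)) tau]) @ \oo --> 1%E; last first.
  by move=> h; rewrite -(cvg_shiftn 2); exact: h.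
apply: (@squeeze_cvge _ _ _ _ (fun n => (1 - (n.+2%:R * (r ^+ n *+ 2)))%:E) _ (cst 1%E)).
- apply: nearW => n; rewrite addn2; apply/andP; split.
    by apply: probability_converges_to_zero_ge; [exact: ltW|exact: Smix].
  by apply: probability_le1; apply: measurable_converges_to_zero; have [] := Smix n.+2.
- have r01 : 0 <= r < 1 by rewrite /r; nra.
  apply: cvg_EFin; first exact: nearW.
  rewrite [X in _ --> X](_ : 1 = 1 - (0 + 0) * 2)%R; last by rewrite addr0 mul0r subr0.
  under eq_fun => n do rewrite -(addn2 n) -(mulr_natr (r ^+ n)) mulrA natrD mulrDl.
  apply: cvgB; first exact: cvg_cst.
  apply: cvgMr_tmp; apply: cvgD; first exact: cvg_natr_mul_expr.
  have [r0 r1] := andP r01.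
  by apply: cvg_geometric; rewrite ger0_norm.
- exact: cvg_cst.
Qed.

(** * Both signs of a centered nondegenerate variable *)

Section centered.
Context d (T : measurableType d) (R : realType) (Q : probability T R).
Variable Z : {RV Q >-> R}.

Let f (t : T) : \bar R := (Z t)%:E.

Let mf : measurable_fun setT f. Proof. exact/measurable_EFinP. Qed.

Let integral_eq0 (g : T -> \bar R) : measurable_fun setT g ->
  (forall t, 0 <= g t)%E -> (\int[Q]_t g t = 0)%E <-> Q [set t | g t != 0%E] = 0%E.
Proof.
move=> mg g0.
have mNg : measurable [set t | g t != 0%E].
  rewrite -[X in measurable X]setTI; apply: emeasurable_neq => //.
have -> : (\int[Q]_t g t = \int[Q]_t `|g t|)%E.
  by apply: eq_integral => t _; rewrite gee0_abs.
split.
  move/(ae_eq_integral_abs Q measurableT mg) => [N [mN N0 sub]].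
  apply: (subset_measure0 _ mN _ N0) => // t /= gt; apply: sub => /= /(_ I).
  exact/eqP.
move=> g00; apply/(ae_eq_integral_abs Q measurableT mg).
exists [set t | g t != 0%E]; split=> // t /=; apply: contra_notN => /eqP ? _ //.
Qed.

(** The integrals of the positive and negative parts have difference [0], so if one sign is null, so
    is the other. Then [Z] vanishes almost surely, against the nonzero variance. *)
Lemma centered_sign_gt0 : ('E_Q[Z] = 0)%E -> ('V_Q[Z] != 0)%E ->
  (0 < Q [set t | 0 < Z t]%R)%E /\ (0 < Q [set t | Z t < 0]%R)%E.
Proof.
move=> EZ VZ.
have mZ : measurable_fun setT Z by [].
have mpos : measurable [set t | 0 < Z t].
  by rewrite -[X in measurable X]setTI; exact: (mZ measurableT _ (@measurable_set_gt0 R)).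
have mneg : measurable [set t | Z t < 0].
  by rewrite -[X in measurable X]setTI; exact: (mZ measurableT _ (@measurable_set_lt0 R)).
have max_neq0 (x : R) : (maxe x%:E 0 != 0)%E = (0 < x).
  by rewrite maxEle lee_fin; case: leP => [|x0]; rewrite ?eqxx// eqe gt_eqF.
have int_pos : (\int[Q]_t (f^\+ t) = 0)%E <-> Q [set t | 0 < Z t]%R = 0%E.
  rewrite integral_eq0//; last exact: measurable_funepos.
  by under eq_set => t do rewrite funeposE max_neq0.
have int_neg : (\int[Q]_t (f^\- t) = 0)%E <-> Q [set t | Z t < 0]%R = 0%E.
  rewrite integral_eq0//; last exact: measurable_funeneg.
  by under eq_set => t do rewrite funenegE -EFinN max_neq0 oppr_gt0.
have int_eq : ((\int[Q]_t (f^\+ t)) - (\int[Q]_t (f^\- t)) = 0)%E.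
  by move: EZ; rewrite unlock integralE.
have not0 : ~ (Q [set t | 0 < Z t]%R = 0%E /\ Q [set t | Z t < 0]%R = 0%E).
  move=> [pos0 neg0]; move/eqP: VZ; apply.
  rewrite /variance unlock EZ/= unlock.
  apply/integral_eq0 => [|t|].
  - apply/measurable_EFinP; apply: measurable_funM; exact: measurable_funB.
  - by rewrite lee_fin -expr2 sqr_ge0.
  have sqE t : ((Z \- cst 0) * (Z \- cst 0)) t = Z t * Z t.
    by rewrite -[LHS]/((Z t - 0) * (Z t - 0)) subr0.
  rewrite -[RHS]pos0 -(measureU0 mpos mneg neg0); congr (Q _).
  apply/seteqP; split=> t /=; rewrite sqE eqe mulf_eq0 orbb neq_lt.
    by move/orP => [|]; [right|left].
  by move=> [->|->]; rewrite ?orbT.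
split; rewrite lt0e measure_ge0 andbT; apply/eqP => Q0; apply: not0; split=> //.
  by apply/int_neg; move: int_eq; rewrite (int_pos.2 Q0) sub0e => /eqP; rewrite oppe_eq0 => /eqP.
by apply/int_pos; move: int_eq; rewrite (int_neg.2 Q0) sube0.
Qed.

End centered.

(** * Sign bounds and independence in the two models *)

Section models.
Context d (T : measurableType d) (R : realType) (Pr : probability T R).
Context (mu : probability R R) (p : R).
Hypothesis p01 : 0 < p <= 1.

Let p0 : 0 < p. Proof. by case/andP: p01. Qed.
Let p1 : 0 <= 1 - p. Proof. by rewrite subr_ge0; case/andP: p01. Qed.

Lemma random_mixed_signs n (S : T -> 'M[R]_n) (h : R) :
  (h%:E <= mu [set x | 0 < x]%R)%E -> (h%:E <= mu [set x | x < 0]%R)%E ->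
  random_mixed Pr mu p S -> mixed_signs Pr (p * h) S.
Proof.
move=> hpos hneg [mS _ lawS indS].
have law_ge i j (B : set R) : measurable B -> (h%:E <= mu B)%E -> i != j ->
    ((p * h)%:E <= Pr [set t | B (S t i j)])%E.
  move=> mB hB ij; rewrite [leRHS](lawS i j ij B mB) /mixed_law -[leLHS]adde0.
  by rewrite leeD ?mule_ge0 ?lee_fin ?measure_ge0// EFinM lee_pmul2l ?lte_fin// .
split=> // [i j|i j|E Eok J JE].
- exact: (law_ge i j _ (@measurable_set_gt0 R) hpos).
- exact: (law_ge i j _ (@measurable_set_lt0 R) hneg).
- apply: indS; apply/fintype.subsetP => e /(fintype.subsetP JE) /Eok /andP[ee _].
  by rewrite inE.
Qed.

Context (q : proportions R).
Hypothesis q_ok : proportions_ok q.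

(** Allows the eight sign patterns to be bounded one at a time, with bound [0] for those to be
    discarded. *)
Lemma interacting_law_ge (U : set (R * R)) (lpp lmm lpm lmp lp0 lzp lm0 lzm : R) :
  let L (f : R * R -> R * R) := (mu \x mu)%E (f @^-1` U) in
  (lpp%:E <= L (fun z => (`|z.1|, `|z.2|))%R)%E ->
  (lmm%:E <= L (fun z => (- `|z.1|, - `|z.2|))%R)%E ->
  (lpm%:E <= L (fun z => (`|z.1|, - `|z.2|))%R)%E ->
  (lmp%:E <= L (fun z => (- `|z.1|, `|z.2|))%R)%E ->
  (lp0%:E <= L (fun z => (`|z.1|, 0))%R)%E ->
  (lzp%:E <= L (fun z => (0, `|z.2|))%R)%E ->
  (lm0%:E <= L (fun z => (- `|z.1|, 0))%R)%E ->
  (lzm%:E <= L (fun z => (0, - `|z.2|))%R)%E ->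
  ((ppp q * lpp + pmm q * lmm + ppm q * (2^-1 * lpm + 2^-1 * lmp)
    + pp0 q * (2^-1 * lp0 + 2^-1 * lzp) + pm0 q * (2^-1 * lm0 + 2^-1 * lzm))%:E
    <= interacting_law mu q U)%E.
Proof.
move=> L h1 h2 h3 h4 h5 h6 h7 h8.
have [[q1 q2 q3 q4 q5] _ _ _] := q_ok.
rewrite /interacting_law /pushforward/=.
rewrite !EFinD !EFinM !EFinD !EFinM.
have half0 : 0 <= 2^-1 :> R by rewrite invr_ge0.
by rewrite !leeD// lee_wpmul2l// !leeD// lee_wpmul2l.
Qed.

(** The two sums weigh the types that can make a given entry positive, respectively negative. The
    factor [2^-1] accounts for the coin that chooses which entry of the pair gets the sign. *)
Let c : R := p * (2^-1 * Num.min (ppp q + ppm q + pp0 q) (pmm q + ppm q + pm0 q)).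

Lemma complex_mixed_signs n (S : T -> 'M[R]_n) (h : R) : 0 <= h ->
  (h%:E <= mu [set x | x != 0]%R)%E ->
  complex_mixed Pr mu p q S -> mixed_signs Pr (c * h) S.
Proof.
move=> h0 hmu [mS _ lawS indS].
have [[q1 q2 q3 q4 q5] qS qp qm] := q_ok.
have mpos := @measurable_set_gt0 R; have mneg := @measurable_set_lt0 R.
have mnz : measurable [set x : R | x != 0].
  by apply: open_measurable; exact: open_neq.
have mfst (B : set R) : measurable B -> measurable (B `*` [set: R]).
  by move=> mB; exact: measurableX.
have msnd (B : set R) : measurable B -> measurable ([set: R] `*` B).
  by move=> mB; exact: measurableX.
have fst_ge (A : set (R * R)) : A = [set x | x != 0] `*` setT -> (h%:E <= (mu \x mu)%E A)%E.
  by move=> ->; rewrite product_measure1E// [X in (_ * X)%E]probability_setT mule1.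
have snd_ge (A : set (R * R)) : A = setT `*` [set x | x != 0] -> (h%:E <= (mu \x mu)%E A)%E.
  by move=> ->; rewrite product_measure1E// [X in (X * _)%E]probability_setT mul1e.
have law_ge (U : set (R * R)) (l : R) : measurable U ->
    (l%:E <= interacting_law mu q U)%E -> c * h <= p * l ->
    ((c * h)%:E <= complex_law mu p q U)%E.
  move=> mU hl cl; apply: (@le_trans _ _ (p * l)%:E); first by rewrite lee_fin.
  rewrite /complex_law -[leLHS]adde0 leeD ?mule_ge0 ?lee_fin ?measure_ge0//.
  by rewrite EFinM lee_pmul2l// lte_fin.
have c1 : c * h <= p * (2^-1 * (ppp q + ppm q + pp0 q) * h).
  by rewrite mulrA ler_wpM2r// /c (ler_wpM2l (ltW p0))// ler_wpM2l ?invr_ge0// ge_min lexx.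
have c2 : c * h <= p * (2^-1 * (pmm q + ppm q + pm0 q) * h).
  by rewrite mulrA ler_wpM2r// /c (ler_wpM2l (ltW p0))// ler_wpM2l ?invr_ge0// ge_min lexx orbT.
have setE1 (A : set (R * R)) : (forall z, A z <-> z.1 != 0) -> A = [set x | x != 0] `*` setT.
  by move=> AP; apply/seteqP; split=> z; rewrite AP /=; [split|case].
have setE2 (A : set (R * R)) : (forall z, A z <-> z.2 != 0) -> A = setT `*` [set x | x != 0].
  by move=> AP; apply/seteqP; split=> z; rewrite AP /=; [split|case].
have pos1 : ((c * h)%:E <= complex_law mu p q ([set x | 0 < x]%R `*` setT))%E.
  apply: law_ge; [exact: mfst| |].
    (* The bound [h] goes to the patterns whose first entry is [|z.1|], which is positive exactly
       when [z.1 != 0]. *)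
    apply: (@interacting_law_ge _ h 0 h 0 h 0 0 0); rewrite ?measure_ge0//;
    by apply/fst_ge/setE1 => z /=; rewrite normr_gt0; split=> [[]|].
  by apply: le_trans c1 _; rewrite (ler_wpM2l (ltW p0))//; nra.
have neg1 : ((c * h)%:E <= complex_law mu p q ([set x | x < 0]%R `*` setT))%E.
  apply: law_ge; [exact: mfst| |].
    apply: (@interacting_law_ge _ 0 h 0 h 0 0 h 0); rewrite ?measure_ge0//;
    by apply/fst_ge/setE1 => z /=; rewrite oppr_lt0 normr_gt0; split=> [[]|].
  by apply: le_trans c2 _; rewrite (ler_wpM2l (ltW p0))//; nra.
have pos2 : ((c * h)%:E <= complex_law mu p q (setT `*` [set x | 0 < x]%R))%E.
  apply: law_ge; [exact: msnd| |].
    apply: (@interacting_law_ge _ h 0 0 h 0 h 0 0); rewrite ?measure_ge0//;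
    by apply/snd_ge/setE2 => z /=; rewrite normr_gt0; split=> [[]|].
  by apply: le_trans c1 _; rewrite (ler_wpM2l (ltW p0))//; nra.
have neg2 : ((c * h)%:E <= complex_law mu p q (setT `*` [set x | x < 0]%R))%E.
  apply: law_ge; [exact: msnd| |].
    apply: (@interacting_law_ge _ 0 h h 0 0 0 0 h); rewrite ?measure_ge0//;
    by apply/snd_ge/setE2 => z /=; rewrite oppr_lt0 normr_gt0; split=> [[]|].
  by apply: le_trans c2 _; rewrite (ler_wpM2l (ltW p0))//; nra.
have sign_ge i j (B : set R) : measurable B -> i != j ->
    ((c * h)%:E <= complex_law mu p q (B `*` setT))%E ->
    ((c * h)%:E <= complex_law mu p q (setT `*` B))%E ->
    ((c * h)%:E <= Pr [set t | B (S t i j)])%E.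
  (* The law is given for increasing pairs only: [S t i j] is the first coordinate if [i < j], and
     the second coordinate of the pair [(j, i)] otherwise. *)
  move=> mB; rewrite -val_eqE neq_ltn => /orP[ij|ji] B1 B2.
    rewrite (_ : [set t | _] = (fun t => (S t i j, S t j i)) @^-1` (B `*` setT)).
      by rewrite lawS//; exact: mfst.
    by apply/seteqP; split=> t /=; [split|case].
  rewrite (_ : [set t | _] = (fun t => (S t j i, S t i j)) @^-1` (setT `*` B)).
    by rewrite lawS//; exact: msnd.
  by apply/seteqP; split=> t /=; [split|case].
split=> // [i j ij|i j ij|E Eok J JE A mA].
- exact: (sign_ge i j _ mpos ij pos1 pos2).
- exact: (sign_ge i j _ mneg ij neg1 neg2).
(* [srt] picks the increasing representative of an edge. The event on an edge of [J] becomes one on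
   the first coordinate of its pair, or on the second if the edge was reversed. *)
pose srt (e : 'I_n * 'I_n) := if (e.1 < e.2)%N then e else (e.2, e.1).
pose X e t := (S t e.1 e.2, S t e.2 e.1).
pose B (e : 'I_n * 'I_n) : set (R * R) :=
  if e \in J then A e `*` setT else setT `*` A (e.2, e.1).
have mB e : measurable (B e) by rewrite /B; case: ifP => _; [exact: mfst|exact: msnd].
have Jok e : e \in J -> (e.1 != e.2) && ((e.2, e.1) \notin J).
  move=> eJ; have /andP[-> eE] := Eok e (fintype.subsetP JE e eJ).
  by apply: contra eE => /(fintype.subsetP JE).
have srt_lt e : e \in J -> ((srt e).1 < (srt e).2)%N.
  move=> /Jok /andP[]; rewrite -val_eqE /= neq_ltn /srt.
  by case: ifP => //= ->.
have srtB e : e \in J -> X (srt e) @^-1` B (srt e) = (fun t => S t e.1 e.2) @^-1` A e.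
  move=> eJ; have /andP[_ /negbTE eJ'] := Jok e eJ.
  rewrite /srt; case: ifP => _; rewrite /B /X /= ?eJ ?eJ'.
    by apply/seteqP; split=> t /=; [case|split].
  by case: e eJ eJ' => e1 e2 /= _ _; apply/seteqP; split=> t /=; [case|split].
(* Two distinct edges with the same representative are reverses of each other, which [J]
   excludes. *)
have srt_inj : {in J &, injective srt}.
  move=> [e1 e2] [e3 e4] eJ eJ'; have /andP[_ /= eN] := Jok _ eJ; have /andP[_ /= eN'] := Jok _ eJ'.
  rewrite /srt /=; case: ifP => _; case: ifP => _ // [h1 h2]; subst.
  - by rewrite eJ in eN'.
  - by rewrite eJ' in eN.
  - by [].
have srtJ : (srt @: J \subset [set e : 'I_n * 'I_n | (e.1 < e.2)%N])%SET.
  by apply/fintype.subsetP => e /imsetP[e' e'J ->]; rewrite inE; exact: srt_lt.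
have := indS _ srtJ B mB; rewrite big_imset//=.
under eq_bigr => e eJ do rewrite -/(X (srt e)) srtB//.
move=> <-; congr (Pr _); apply/seteqP; split=> t /= H.
  move=> e' /imsetP[e eJ ->].
  by rewrite -[preimage _ _]/(X (srt e) @^-1` B (srt e)) srtB//; exact: H.
move=> e eJ; rewrite -srtB//.
by apply: (H (srt e)); exact: imset_f.
Qed.

End models.

Unset Implicit Arguments.

Theorem theorem2 (R : realType)
    (dZ : measure_display) (TZ : measurableType dZ) (Q : probability TZ R)
    (Z : {RV Q >-> R}) (sigma : R)
    (hE : ('E_Q[Z] = 0)%E) (hsigma : 0 < sigma)
    (hV : ('V_Q[Z] = (sigma ^+ 2)%:E)%E)
    (p : R) (hp : 0 < p <= 1)
    (d : nat -> measure_display) (T : forall n : nat, measurableType (d n))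
    (Pr : forall n : nat, probability (T n) R)
    (S : forall n : nat, T n -> 'M[R]_n)
    (hS : (forall n : nat, random_mixed (Pr n) (distribution Q Z) p (S n)) \/
          (exists q : proportions R, proportions_ok q /\
            forall n : nat,
              complex_mixed (Pr n) (distribution Q Z) p q (S n)))
    (tau : nat) :
  let stable (n : nat) : set (T n) :=
    [set t | converges_to_zero (interaction_matrix (S n t)) tau] in
  (forall n : nat, measurable (stable n)) /\
  Pr n (stable n) @[n --> \oo] --> 1%E.

Proof.
have [Qpos Qneg] : (0 < Q [set t | 0 < Z t]%R)%E /\ (0 < Q [set t | Z t < 0]%R)%E.
  by apply: centered_sign_gt0; rewrite // hV eqe expf_neq0// gt_eqF.
pose mu := distribution Q Z.
have mupos : (0 < mu [set x | 0 < x]%R)%E by [].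
have muneg : (0 < mu [set x | x < 0]%R)%E by [].
have fineE (A : set R) : measurable A -> mu A = (fine (mu A))%:E.
  by move=> mA; rewrite fineK// fin_num_measure.
have mpos := @measurable_set_gt0 R; have mneg := @measurable_set_lt0 R.
(* A common lower bound for the masses of the two signs of [Z]. *)
pose h := Num.min (fine (mu [set x | 0 < x])) (fine (mu [set x | x < 0])).
have h0 : 0 < h by rewrite lt_min -!lte_fin -!fineE// mupos.
have hpos : (h%:E <= mu [set x | 0 < x]%R)%E.
  by rewrite [leRHS]fineE// lee_fin ge_min lexx.
have hneg : (h%:E <= mu [set x | x < 0]%R)%E.
  by rewrite [leRHS]fineE// lee_fin ge_min lexx orbT.
have h1 : h <= 1.
  by rewrite -lee_fin (le_trans hpos)// probability_le1.
have [p0 p1] := andP hp.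
have [c c01 Smix] : exists2 c, 0 < c <= 1 & forall n, mixed_signs (Pr n) c (S n).
  case: hS => [Smix|[q [qok Smix]]].
    exists (p * h); first by rewrite mulr_gt0//= mulr_ile1// ltW.
    by move=> n; apply: random_mixed_signs (Smix n).
  have [[q1 q2 q3 q4 q5] qS qp qm] := qok.
  set m := Num.min (ppp q + ppm q + pp0 q) (pmm q + ppm q + pm0 q).
  (* As the proportions sum to [1], the two strict standing assumptions say that each sum in the
     minimum is positive. *)
  have m0 : 0 < m by rewrite lt_min; apply/andP; split; lra.
  have m1 : m <= 1 by rewrite ge_min; apply/orP; left; lra.
  have hnz : (h%:E <= mu [set x | x != 0]%R)%E.
    apply: le_trans hpos _; apply: le_measure; rewrite ?inE//.
      by apply: open_measurable; exact: open_neq.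
    by move=> x /= x0; rewrite gt_eqF.
  exists (p * (2^-1 * m) * h).
    rewrite !mulr_gt0 ?invr_gt0//= mulr_ile1 ?mulr_ge0 ?invr_ge0 ?(ltW p0) ?(ltW m0) ?(ltW h0)//.
    by rewrite mulr_ile1 ?mulr_ge0 ?invr_ge0 ?(ltW p0) ?(ltW m0)//; lra.
  by move=> n; apply: (complex_mixed_signs hp qok (ltW h0) hnz (Smix n)).
split=> [n|]; first by apply: measurable_converges_to_zero; have [] := Smix n.
exact: cvg_probability_converges_to_zero c01 Smix.
Qed.
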